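(* Let $n_1,n_2,n_3$ be integers with $3\le n_1,n_2\le n_3$. If $3\max(n_1,n_2)\le 2n_3\le n_1n_2$, then for $G=K_{n_1+1}\times K_{n_2+1}\times K_{n_3+1}$ the metric dimension $\dim(G)$, the location-domination number $\gamma^L(G)$, and the location-total-domination number $\gamma^L_t(G)$ are all equal to $2(n_3+1)-1$.
   Context: $K_{m_1}\times K_{m_2}\times K_{m_3}$: vertices are triples $(x_1,x_2,x_3)$, $1\le x_i\le m_i$, adjacent iff they differ in every coordinate. A set $W$ of vertices is resolving if for every two distinct vertices $x,y\notin W$ some $w\in W$ has $d(x,w)\ne d(y,w)$; $\dim(G)$ is the minimum size of a resolving set. A dominating set is a vertex set $D$ such that every vertex is in $D$ or adjacent to a vertex of $D$; a total-dominating set is one such that every vertex is adjacent to a vertex of $D$. A locating-dominating (resp. locating-total-dominating) set is a resolving set that is also dominating (resp. total-dominating); $\gamma^L(G)$ (resp. $\gamma^L_t(G)$) is the minimum size of such a set. *)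

(* Defs.v *)
From mathcomp Require Import all_boot.
Set Implicit Arguments. Unset Strict Implicit. Unset Printing Implicit Defensive.

Section Graph.
Variables (T : finType) (e : rel T).

Fixpoint reach (k : nat) (x y : T) : bool :=
  if k is k'.+1 then (x == y) || [exists z, e x z && reach k' z y]
  else x == y.

(* graph distance: Some d with d the least k such that reach k x y,
   None (= infinity) if y is not reachable from x.  Shortest walks
   have fewer than #|T| edges, so searching k < #|T| suffices. *)
Definition dist (x y : T) : option nat :=
  ohead [seq k <- iota 0 #|T| | reach k x y].

Definition resolving (W : {set T}) : Prop :=
  forall x y : T, x \notin W -> y \notin W -> x != y ->
    exists2 w, w \in W & dist x w != dist y w.

Definition dominating (D : {set T}) : Prop :=
  forall v : T, v \in D \/ exists2 u, u \in D & e v u.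

Definition total_dominating (D : {set T}) : Prop :=
  forall v : T, exists2 u, u \in D & e v u.

Definition locating_dominating (W : {set T}) : Prop :=
  resolving W /\ dominating W.

Definition locating_total_dominating (W : {set T}) : Prop :=
  resolving W /\ total_dominating W.

Definition min_card (P : {set T} -> Prop) (k : nat) : Prop :=
  (exists2 W, P W & #|W| = k) /\ (forall W, P W -> k <= #|W|).

Definition metric_dim_is := min_card resolving.
Definition loc_dom_number_is := min_card locating_dominating.
Definition loc_total_dom_number_is := min_card locating_total_dominating.

End Graph.

Definition KKK_vertex (m1 m2 m3 : nat) : finType := ('I_m1 * 'I_m2 * 'I_m3)%type.

Definition KKK_adj (m1 m2 m3 : nat) : rel (KKK_vertex m1 m2 m3) :=
  fun x y => [&& x.1.1 != y.1.1, x.1.2 != y.1.2 & x.2 != y.2].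
Arguments KKK_adj : clear implicits.

(* Main.v *)
Require Import Defs.
From mathcomp Require Import zify all_boot.
Set Implicit Arguments. Unset Strict Implicit. Unset Printing Implicit Defensive.

(** Distances are 1 (adjacent) or 2, so W resolves iff distinct vertices outside
    W have distinct neighbourhoods in W.

    Lower bound: two layers x3 = c and x3 = c' contain together at least three
    points of W, so all layers but one contain at least two, and the last one
    contains a point unless all others contain three.

    Upper bound: W consists of (0,0,0) and, for each k < n3, of the two points
    (r+1, c+1, k+1), (r'+1, c'+1, k+1), where (r, c), (r', c') is the k-th of n3
    pairs of cells of the n1 x n2 grid with r <> r', c <> c'. If all the cells
    are distinct, all the opposite corners (r, c'), (r', c) are distinct, and
    every row and column contains three of the cells, then W works: the points
    of W agreeing with x = (x1, x2, x3) in some coordinate determine x1 and x2,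
    because one column and one layer cannot cover a row, and then x3, because
    (x1, x2) is an opposite corner of at most one pair. Having all these
    properties except the last one passes to subfamilies, so it is enough to
    find a family of floor(n1 n2 / 2) pairs with a small subfamily meeting every
    row and column three times. If n2 is even, columns 2t, 2t+1 receive the pairs
    (i, 2t), (i+1, 2t+1) with i modulo n1. If both are odd, a 5 x 5 or 7 x 7
    solution is completed by three blocks with an even side. *)

(** * Families of diagonal pairs of grid cells *)

(* A pair of cells, each given as (row, column). *)
Definition diagonal : eqType := ((nat * nat) * (nat * nat))%type.

Definition transpose (x : diagonal) : diagonal :=
  ((x.1.2, x.1.1), (x.2.2, x.2.1)).
Definition antidiagonal (x : diagonal) : diagonal :=
  ((x.1.1, x.2.2), (x.2.1, x.1.2)).
Definition proper_diagonal (x : diagonal) : bool :=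
  (x.1.1 != x.2.1) && (x.1.2 != x.2.2).
Definition meets (x y : diagonal) : bool :=
  [|| x.1 == y.1, x.1 == y.2, x.2 == y.1 | x.2 == y.2].
Definition clash (x y : diagonal) : bool :=
  meets x y || meets (antidiagonal x) (antidiagonal y).
Definition in_box (r0 r1 c0 c1 : nat) (x : diagonal) : bool :=
  [&& r0 <= x.1.1 < r1, r0 <= x.2.1 < r1, c0 <= x.1.2 < c1 & c0 <= x.2.2 < c1].
Definition hits_row (i : nat) (x : diagonal) : bool :=
  (x.1.1 == i) || (x.2.1 == i).
Definition hits_col (j : nat) (x : diagonal) : bool :=
  (x.1.2 == j) || (x.2.2 == j).

(** Every pair clashes with itself, so disjointness of cells and of opposite corners reads: clashing
    members are equal. *)
Definition packing (s : seq diagonal) : Prop :=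
  {in s, forall x, proper_diagonal x} /\ {in s &, forall x y, clash x y -> x = y}.

Definition balanced (a b : nat) (s : seq diagonal) : Prop :=
  (forall i, i < a -> 3 <= count (hits_row i) s) /\
  (forall j, j < b -> 3 <= count (hits_col j) s).

Definition design (a b k : nat) : Prop :=
  exists s, [/\ uniq s, size s = k, {in s, forall x, in_box 0 a 0 b x},
                packing s & balanced a b s].

Lemma count_ge3 (T : eqType) (P : pred T) (s t : seq T) :
  uniq t -> size t = 3 -> {in t, forall x, (x \in s) && P x} -> 3 <= count P s.
Proof.
move=> ut <- ts; rewrite -size_filter; apply: uniq_leq_size => // x /ts /andP[xs Px].
by rewrite mem_filter Px.
Qed.

Lemma packing_sub (s t : seq diagonal) :
  {subset s <= t} -> packing t -> packing s.
Proof.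
move=> st [tP tI]; split=> [x /st /tP //|x y /st xt /st yt]; exact: tI.
Qed.

Lemma transposeK : involutive transpose.
Proof. by case=> [[p q] [r s]]. Qed.

Lemma clash_transpose (x y : diagonal) :
  clash (transpose x) (transpose y) -> clash x y.
Proof.
case: x y => [[p q] [r s]] [[p' q'] [r' s']].
by case/orP=> /or4P[] /eqP[-> ->]; rewrite /clash /meets eqxx ?orbT.
Qed.

Lemma packing_transpose (s : seq diagonal) :
  packing s -> packing (map transpose s).
Proof.
move=> [sP sI]; split=> [_ /mapP[x xs ->]|_ _ /mapP[x xs ->] /mapP[y ys ->]].
  by move: (sP x xs); rewrite /proper_diagonal andbC.
by move/clash_transpose/sI ->.
Qed.

Lemma in_box_transpose (r0 r1 c0 c1 : nat) (x : diagonal) :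
  in_box r0 r1 c0 c1 (transpose x) = in_box c0 c1 r0 r1 x.
Proof. by rewrite /in_box /=; lia. Qed.

Lemma design_sym (a b k : nat) : design a b k -> design b a k.
Proof.
move=> [s [us <- box sP [rows cols]]]; exists (map transpose s); split.
- by rewrite (map_inj_uniq (inv_inj transposeK)).
- by rewrite size_map.
- by move=> _ /mapP[x xs ->]; rewrite in_box_transpose box.
- exact: packing_transpose.
- by split=> i Hi; rewrite count_map; [exact: cols|exact: rows].
Qed.

(** The packing property passes to subfamilies and balance to larger families, so every size between
    those of [s] and [F] is attained. *)
Lemma design_pad (a b k : nat) (s F : seq diagonal) :
  uniq s -> uniq F -> {subset s <= F} -> size s <= k <= size F ->
  {in F, forall x, in_box 0 a 0 b x} -> packing F -> balanced a b s ->
  design a b k.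
Proof.
move=> us uF sF /andP[sk kF] box FP [rows cols].
pose r := [seq x <- F | x \notin s].
have sFr : perm_eq (s ++ r) F.
  apply: uniq_perm => //.
    rewrite cat_uniq us filter_uniq // andbT; apply/hasPn => x.
    by rewrite mem_filter => /andP[].
  move=> x; rewrite mem_cat mem_filter.
  by case xs: (x \in s) => //=; rewrite (sF _ xs).
pose t := s ++ take (k - size s) r.
have tE : t = take k (s ++ r).
  rewrite /t take_cat; case: ltnP => // ks.
  have -> : k = size s by apply/eqP; rewrite eqn_leq sk ltnW.
  by rewrite subnn take0 cats0 take_size.
have tF : {subset t <= F}.
  by move=> x; rewrite tE => /mem_take; rewrite (perm_mem sFr).
exists t; split.
- by rewrite tE take_uniq // (perm_uniq sFr).
- by rewrite tE size_takel // (perm_size sFr).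
- by move=> x /tF /box.
- exact: packing_sub FP.
- by split=> i Hi; rewrite count_cat;
    [apply: leq_trans (rows i Hi) _|apply: leq_trans (cols i Hi) _]; rewrite leq_addr.
Qed.

Lemma packing_cat (s t : seq diagonal) :
  {in s & t, forall x y, ~~ clash x y} -> packing s -> packing t -> packing (s ++ t).
Proof.
move=> st [sP sI] [tP tI]; split=> [x|x y]; rewrite !mem_cat.
  by case/orP; [exact: sP|exact: tP].
have clashC : clash x y = clash y x.
  have meetsC u v : meets u v = meets v u.
    rewrite /meets (eq_sym v.1 u.1) (eq_sym v.1 u.2) (eq_sym v.2 u.1) (eq_sym v.2 u.2).
    by rewrite (orbCA (u.1 == v.2)).
  by rewrite /clash !(meetsC x, meetsC (antidiagonal x)).
case/orP=> hx /orP[] hy; [exact: sI| | |exact: tI].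
  by move=> c; move: (st _ _ hx hy); rewrite c.
by rewrite clashC => c; move: (st _ _ hy hx); rewrite c.
Qed.

Lemma uniq_cat_noclash (s t : seq diagonal) :
  {in s & t, forall x y, ~~ clash x y} -> uniq s -> uniq t -> uniq (s ++ t).
Proof.
move=> st us ut; rewrite cat_uniq us ut andbT; apply/hasPn => x xt.
by apply/negP => xs; move: (st _ _ xs xt); rewrite /clash /meets eqxx.
Qed.

(** The opposite corners of a pair use the same rows and columns as its cells, so they stay in its
    box too. *)
Lemma boxes_noclash (r0 r1 c0 c1 r0' r1' c0' c1' : nat) (x y : diagonal) :
  in_box r0 r1 c0 c1 x -> in_box r0' r1' c0' c1' y ->
  [|| r1 <= r0', r1' <= r0, c1 <= c0' | c1' <= c0] -> ~~ clash x y.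
Proof.
case: x y => [[p q] [r s]] [[p' q'] [r' s']].
rewrite /in_box /= => hx hy hb; apply/negP.
by case/orP=> /or4P[] /eqP[? ?]; subst; lia.
Qed.

(** * Grids with an even number of columns *)

Definition cyclic_succ (a i : nat) : nat := if i.+1 < a then i.+1 else 0.

Definition arc (a r0 c0 : nat) (p : nat * nat) : diagonal :=
  ((r0 + p.1, c0 + 2 * p.2), (r0 + cyclic_succ a p.1, c0 + (2 * p.2).+1)).

Definition block (a m r0 c0 : nat) : seq diagonal :=
  [seq arc a r0 c0 (i, t) | i <- iota 0 a, t <- iota 0 m].

Lemma arc_inj (a r0 c0 : nat) : injective (arc a r0 c0).
Proof. by move=> [i t] [i' t'] [] /= e1 e2 _ _; congr pair; lia. Qed.

Lemma blockP (a m r0 c0 : nat) (x : diagonal) :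
  reflect (exists2 p, (p.1 < a) && (p.2 < m) & x = arc a r0 c0 p)
          (x \in block a m r0 c0).
Proof.
apply: (iffP allpairsP) => [[[i t] [/= hi ht ->]]|[[i t] /andP[/= hi ht] ->]].
  by exists (i, t) => //=; move: hi ht; rewrite !mem_iota; lia.
by exists (i, t); rewrite !mem_iota !leq0n.
Qed.

Lemma mem_block (a m r0 c0 i t : nat) :
  i < a -> t < m -> arc a r0 c0 (i, t) \in block a m r0 c0.
Proof. by move=> hi ht; apply/blockP; exists (i, t); rewrite //= hi. Qed.

Lemma uniq_block (a m r0 c0 : nat) : uniq (block a m r0 c0).
Proof.
apply: allpairs_uniq; rewrite ?iota_uniq // => -[i t] [i' t'] _ _ /=.
exact: arc_inj.
Qed.

Lemma size_block (a m r0 c0 : nat) : size (block a m r0 c0) = a * m.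
Proof. by rewrite size_allpairs !size_iota. Qed.

Lemma block_in_box (a m r0 c0 : nat) :
  {in block a m r0 c0, forall x, in_box r0 (r0 + a) c0 (c0 + 2 * m) x}.
Proof.
move=> _ /blockP[[i t] /andP[/= hi ht] ->].
by rewrite /in_box /= /cyclic_succ; case: ifP; lia.
Qed.

(* The columns [2t], [2t+1] carry the pairs [(i, 2t)], [(i+1, 2t+1)]: the
   cells and the antidiagonal cells are both all cells of the two columns. *)
Lemma packing_block (a m r0 c0 : nat) : a != 1 -> packing (block a m r0 c0).
Proof.
move=> a1; split=> [_ /blockP[[i t] /andP[/= hi ht] ->]|].
  by rewrite /proper_diagonal /= /cyclic_succ; case: ifP; lia.
move=> _ _ /blockP[[i t] /andP[/= hi ht] ->] /blockP[[i' t'] /andP[/= hi' ht'] ->] C.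
suff [-> ->] : i = i' /\ t = t' by [].
move: C; rewrite /clash /meets.
by case/orP=> /or4P[] /eqP[] /=; rewrite /cyclic_succ; do ?case: ifP; lia.
Qed.

(** Three arcs per column pair is the fewest that balance allows; the start rows advance by two from
    one column pair to the next. *)
Definition tight_block (a m r0 c0 : nat) : seq diagonal :=
  [seq arc a r0 c0 ((2 * t + j) %% a, t) | t <- iota 0 m, j <- iota 0 3].

Lemma mem_tight_block (a m r0 c0 i t j : nat) :
  t < m -> j < 3 -> i = (2 * t + j) %% a ->
  arc a r0 c0 (i, t) \in tight_block a m r0 c0.
Proof. by move=> tm j3 ->; apply/allpairsP; exists (t, j); rewrite !mem_iota !leq0n. Qed.

Lemma sub_tight_block (a m r0 c0 : nat) :
  0 < a -> {subset tight_block a m r0 c0 <= block a m r0 c0}.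
Proof.
move=> a0 x /allpairsP[[t j] [/= + _ ->]]; rewrite mem_iota => tm.
by apply: mem_block; rewrite // ltn_mod.
Qed.

Lemma uniq_tight_block (a m r0 c0 : nat) : 3 <= a -> uniq (tight_block a m r0 c0).
Proof.
move=> a3; apply: allpairs_uniq; rewrite ?iota_uniq // => p q.
move=> /allpairsP[[t j] [_ j3 ->]] /allpairsP[[t' j'] [_ j3' ->]].
move: j3 j3'; rewrite !mem_iota /= => j3 j3'.
move=> /arc_inj[/eqP + et]; rewrite /= -et eqn_modDl.
by rewrite !modn_small; [move/eqP-> | lia | lia].
Qed.

Lemma size_tight_block (a m r0 c0 : nat) : size (tight_block a m r0 c0) = 3 * m.
Proof. by rewrite size_allpairs !size_iota mulnC. Qed.

Lemma count_arcs_ge3 (a r0 c0 : nat) (P : pred diagonal) (s : seq diagonal)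
    (p q r : nat * nat) :
  let f := arc a r0 c0 in
  [&& p != q, p != r & q != r] ->
  (f p \in s) && P (f p) -> (f q \in s) && P (f q) -> (f r \in s) && P (f r) ->
  3 <= count P s.
Proof.
move=> f /and3P[pq pr qr] hp hq hr; apply: (@count_ge3 _ _ _ [:: f p; f q; f r]) => //.
  by rewrite /= !inE !(inj_eq (@arc_inj a r0 c0)) negb_or pq pr qr.
by move=> x; rewrite !inE => /or3P[]/eqP->.
Qed.

Lemma tight_block_cols (a m r0 c0 j : nat) :
  3 <= a -> c0 <= j < c0 + 2 * m -> 3 <= count (hits_col j) (tight_block a m r0 c0).
Proof.
move=> a3 hj; pose t := (j - c0)./2; have tm : t < m by rewrite /t; lia.
have hit k : k < 3 -> (arc a r0 c0 ((2 * t + k) %% a, t) \in tight_block a m r0 c0) &&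
    hits_col j (arc a r0 c0 ((2 * t + k) %% a, t)).
  move=> k3; rewrite (mem_tight_block _ _ tm k3) //.
  by rewrite /hits_col /= /t; lia.
apply: (count_arcs_ge3 _ (hit 0 isT) (hit 1 isT) (hit 2 isT)).
by rewrite !xpair_eqE eqxx !andbT !eqn_modDl !modn_small; lia.
Qed.

(** Row [i] is hit by the arcs starting in rows [i-1] and [i]. Among the values [2t+j] below [a],
    odd ones occur once and positive even ones twice, so these two rows supply three arcs; rows 0
    and 1 need the wrap-around. *)
Lemma tight_block_rows (a m r0 c0 i : nat) :
  3 <= a -> a <= 2 * m -> i < a ->
  3 <= count (hits_row (r0 + i)) (tight_block a m r0 c0).
Proof.
move=> a3 am ia.
have hit k t j : k < a -> t < m -> j < 3 -> (2 * t + j = k) \/ (2 * t + j = k + a) ->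
    k = i \/ cyclic_succ a k = i ->
    (arc a r0 c0 (k, t) \in tight_block a m r0 c0) &&
    hits_row (r0 + i) (arc a r0 c0 (k, t)).
  move=> ka tm j3 h hk; apply/andP; split.
    apply: (mem_tight_block _ _ tm j3).
    by case: h => ->; rewrite ?modnDr modn_small.
  by rewrite /hits_row /=; case: hk => ->; rewrite eqxx ?orbT.
(* Column pair [l] has both [a-1] and [a], that is row 0, among its starts; [l < m] because
   [a <= 2m]. *)
pose l := (a.-1)./2.
have succ k : k.+1 < a -> cyclic_succ a k = k.+1 by rewrite /cyclic_succ => ->.
have succ_last : cyclic_succ a a.-1 = 0.
  by rewrite /cyclic_succ; case: ifP; lia.
have [i0|i_gt0] := posnP i.
  apply: (count_arcs_ge3 (p := (0, 0)) (q := (0, l)) (r := (a.-1, l))).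
  - by rewrite !xpair_eqE /l; lia.
  - by apply: (hit _ _ 0); lia.
  - by apply: (hit _ _ (a - 2 * l)); rewrite /l; lia.
  - by apply: (hit _ _ (a.-1 - 2 * l)); rewrite /l; lia.
have succ_pred : cyclic_succ a i.-1 = i by rewrite succ; lia.
pose t := i./2.
have [oi|ei] := boolP (odd i); last first.
  apply: (count_arcs_ge3 (p := (i, t)) (q := (i, t.-1)) (r := (i.-1, t.-1))).
  - by rewrite !xpair_eqE /t; lia.
  - by apply: (hit _ _ 0); rewrite /t; lia.
  - by apply: (hit _ _ 2); rewrite /t; lia.
  - by apply: (hit _ _ 1); rewrite /t; lia.
have [i1|i1] := eqVneq i 1.
  apply: (count_arcs_ge3 (p := (1, 0)) (q := (0, 0)) (r := (0, l))).
  - by rewrite !xpair_eqE /l; lia.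
  - by apply: (hit _ _ 1); lia.
  - by apply: (hit _ _ 0); rewrite ?succ; lia.
  - by apply: (hit _ _ (a - 2 * l)); rewrite ?succ /l; lia.
apply: (count_arcs_ge3 (p := (i, t)) (q := (i.-1, t)) (r := (i.-1, t.-1))).
- by rewrite !xpair_eqE /t; lia.
- by apply: (hit _ _ 1); rewrite /t; lia.
- by apply: (hit _ _ 0); rewrite /t; lia.
- by apply: (hit _ _ 2); rewrite /t; lia.
Qed.

(* The sequence of rows is [0, 0, 1, 2, 2, 3, 4, 4, 5, ...], so that any two
   consecutive rows together start three arcs. *)
Definition tall_index (m k : nat) : nat * nat :=
  (2 * (k %/ 3) + (k %% 3)./2, k %% m).

(** The length, half of [3a] rounded up, is the number of indices whose start row is below [a]. *)
Definition tall_block (a m : nat) : seq diagonal :=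
  [seq arc a 0 0 (tall_index m k) | k <- iota 0 ((3 * a).+1)./2].

(** Equal start rows force [k] and [l] to be equal or consecutive, and consecutive numbers differ
    modulo [m]. *)
Lemma tall_index_inj (m : nat) : 2 <= m -> injective (tall_index m).
Proof.
move=> m2 k l [e1 e2].
have succ_mod n : n.+1 %% m <> n %% m.
  move/eqP; rewrite -addn1 -[X in _ == X %% _]addn0 eqn_modDl.
  by rewrite !modn_small; lia.
have [->//|[kl|lk]] : k = l \/ k = l.+1 \/ l = k.+1 by lia.
  by case: (succ_mod l); rewrite -kl.
by case: (succ_mod k); rewrite -lk.
Qed.

Lemma uniq_tall_block (a m : nat) : 2 <= m -> uniq (tall_block a m).
Proof.
move=> m2; rewrite map_inj_uniq ?iota_uniq // => k l /arc_inj.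
exact: tall_index_inj.
Qed.

Lemma sub_tall_block (a m : nat) :
  2 <= m -> {subset tall_block a m <= block a m 0 0}.
Proof.
move=> m2 x /mapP[k]; rewrite mem_iota => ka ->.
by apply: mem_block; [lia|rewrite ltn_mod; lia].
Qed.

Lemma count_tall_block_ge3 (a m : nat) (P : pred diagonal) (k1 k2 k3 : nat) :
  2 <= m -> k1 < k2 < k3 -> k3 < ((3 * a).+1)./2 ->
  P (arc a 0 0 (tall_index m k1)) -> P (arc a 0 0 (tall_index m k2)) ->
  P (arc a 0 0 (tall_index m k3)) -> 3 <= count P (tall_block a m).
Proof.
move=> m2 k123 k3N h1 h2 h3.
have mem k : k < ((3 * a).+1)./2 -> arc a 0 0 (tall_index m k) \in tall_block a m.
  by move=> kN; apply: map_f; rewrite mem_iota.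
apply: (count_arcs_ge3 (a := a) (r0 := 0) (c0 := 0) (p := tall_index m k1)
          (q := tall_index m k2) (r := tall_index m k3)).
- by rewrite !(inj_eq (tall_index_inj m2)); lia.
- by rewrite mem ?h1 //; lia.
- by rewrite mem ?h2 //; lia.
- by rewrite mem ?h3 //; lia.
Qed.

(** Column pairs are used cyclically, and [2m <= a] gives at least [3m] arcs, so each column pair
    occurs three times. Row [i > 0] meets three consecutive arcs; row 0 meets the first two and the
    last, which wraps around. *)
Lemma balanced_tall_block (a m : nat) :
  3 <= a -> 2 <= m -> 2 * m <= a -> balanced a (2 * m) (tall_block a m).
Proof.
move=> a3 m2 ma; split=> [i ia|j jm]; last first.
  pose t := j./2; have tm : t < m by rewrite /t; lia.
  have hit k : k %% m = t -> hits_col j (arc a 0 0 (tall_index m k)).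
    by move=> kt; rewrite /hits_col /= kt /t; lia.
  apply: (count_tall_block_ge3 (k1 := t) (k2 := t + m) (k3 := t + m + m)) => //;
    try apply: hit; rewrite ?modnDr ?modn_small //; lia.
have hit k : let r := 2 * (k %/ 3) + (k %% 3)./2 in r = i \/ cyclic_succ a r = i ->
    hits_row i (arc a 0 0 (tall_index m k)).
  by move=> r; rewrite /hits_row /= !add0n -/r => -[]->; rewrite eqxx ?orbT.
have succ k : k < a -> k.+1 = i -> cyclic_succ a k = i.
  by move=> ka ki; rewrite /cyclic_succ; case: ifP; lia.
have succ_last k : k = a.-1 -> cyclic_succ a k = 0.
  by move=> ->; rewrite /cyclic_succ; case: ifP; lia.
have [i0|i_gt0] := posnP i.
  apply: (count_tall_block_ge3 (k1 := 0) (k2 := 1) (k3 := (((3 * a).+1)./2).-1)) => //.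
  - lia.
  - lia.
  - by apply: hit; left.
  - by apply: hit; left.
  - by apply: hit; right; rewrite succ_last; lia.
(* The first of three consecutive indices whose start rows are [i-1] or [i]. *)
pose k := if odd i then 3 * i./2 else (3 * i./2).-1.
have hk : k < k.+1 < k.+2 by lia.
have hit_row n : let r := 2 * (n %/ 3) + (n %% 3)./2 in (r == i) || (r == i.-1) ->
    hits_row i (arc a 0 0 (tall_index m n)).
  move=> r /orP[]/eqP e; apply: hit; rewrite -/r; first by left.
  by right; apply: succ; lia.
by apply: (count_tall_block_ge3 m2 hk); try apply: hit_row; rewrite /k; case: ifP; lia.
Qed.

(** The bounds on [k] are the sizes of three families: [3m] for the tight one, half of [3a] rounded
    up for the tall one, [a * m] for the whole block. *)
Lemma design_even (a m k : nat) :
  3 <= a -> 2 <= m -> 3 * a <= 2 * k -> 3 * m <= k -> k <= a * m ->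
  design a (2 * m) k.
Proof.
move=> a3 m2 ak mk kam.
have box : {in block a m 0 0, forall x, in_box 0 a 0 (2 * m) x}.
  by move=> x /block_in_box.
have pack : packing (block a m 0 0) by apply: packing_block; lia.
have [am|ma] := leqP a (2 * m).
  apply: (design_pad (s := tight_block a m 0 0) (F := block a m 0 0)) => //.
  - exact: uniq_tight_block.
  - exact: uniq_block.
  - by apply: sub_tight_block; lia.
  - by rewrite size_tight_block size_block mk.
  - split=> [i ia|j jm]; [exact: (tight_block_rows 0)|exact: tight_block_cols].
apply: (design_pad (s := tall_block a m) (F := block a m 0 0)) => //.
- exact: uniq_tall_block.
- exact: uniq_block.
- exact: sub_tall_block.
- by rewrite size_map size_iota size_block; lia.
- by apply: balanced_tall_block => //; lia.
Qed.

(** * Odd grids *)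

(** The base square [B] sits in a corner, [F2] fills the new columns beside it, [F3] the new rows
    below it, and [F1] the remaining block. Together they leave a single cell uncovered. *)
Lemma design_extend (b k0 h m k : nat) (B : seq diagonal) :
  3 <= b -> uniq B -> {in B, forall x, in_box 0 b 0 b x} -> packing B ->
  balanced b b (take k0 B) -> 2 * size B = (b * b).-1 -> k0 <= size B ->
  (h == 0) || (2 <= h <= m) -> k0 + 3 * m <= k ->
  2 * k <= (b + 2 * h) * (b + 2 * m) -> design (b + 2 * h) (b + 2 * m) k.
Proof.
move=> b3 uB boxB packB [rowsB colsB] sizeB k0B hm k0mk kle.
pose F1 := block (2 * h) m b b; pose F2 := block b m 0 b.
pose F3 := map transpose (block b h 0 b).
have box1 : {in F1, forall x, in_box b (b + 2 * h) b (b + 2 * m) x}.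
  exact: block_in_box.
have box2 : {in F2, forall x, in_box 0 b b (b + 2 * m) x}.
  by move=> x /block_in_box.
have box3 : {in F3, forall x, in_box b (b + 2 * h) 0 b x}.
  by move=> _ /mapP[x /block_in_box xb ->]; rewrite in_box_transpose.
have dis1 : {in F2 & F3, forall x y, ~~ clash x y}.
  by move=> x y /box2 hx /box3 hy; apply: boxes_noclash hx hy _; rewrite leqnn.
have dis2 : {in F1 & F2 ++ F3, forall x y, ~~ clash x y}.
  move=> x y /box1 hx; rewrite mem_cat => /orP[/box2|/box3] hy;
    by apply: boxes_noclash hx hy _; rewrite leqnn ?orbT.
have dis3 : {in B & F1 ++ F2 ++ F3, forall x y, ~~ clash x y}.
  move=> x y /boxB hx; rewrite !mem_cat => /or3P[/box1|/box2|/box3] hy;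
    by apply: boxes_noclash hx hy _; rewrite leqnn ?orbT.
(* [E] hits the rows and columns beyond [b]. [F1] serves both if it has at least three rows, whence
   [h <> 1]; for [h = 0] only columns are new, and [F2] provides for them. *)
pose E := if h == 0 then tight_block b m 0 b else tight_block (2 * h) m b b.
have subE : {subset E <= F1 ++ F2 ++ F3}.
  have sub2 : {subset tight_block b m 0 b <= F2} by apply: sub_tight_block; lia.
  move=> x; rewrite /E !mem_cat; case: ifP => h0; first by move/sub2 ->; rewrite orbT.
  have sub1 : {subset tight_block (2 * h) m b b <= F1} by apply: sub_tight_block; lia.
  by move/sub1 ->.
have uF : uniq (B ++ F1 ++ F2 ++ F3).
  do 3![apply: uniq_cat_noclash => //; rewrite ?uniq_block //].
  by rewrite (map_inj_uniq (inv_inj transposeK)) uniq_block.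
have sizeE : size E = 3 * m by rewrite /E; case: ifP; rewrite size_tight_block.
apply: (design_pad (s := take k0 B ++ E) (F := B ++ F1 ++ F2 ++ F3)) => //.
- apply: uniq_cat_noclash => [x y /mem_take xB /subE yF||]; first exact: dis3.
  + exact: take_uniq.
  + by rewrite /E; case: ifP => h0; apply: uniq_tight_block; lia.
- move=> x; rewrite [in X in X -> _]mem_cat mem_cat.
  by move=> /orP[/mem_take->//|/subE->]; rewrite orbT.
- rewrite !size_cat size_takel // sizeE size_map !size_block.
  apply/andP; split; first lia.
  move: kle; rewrite !mulnDl !mulnDr; nia.
- by move=> x; rewrite !mem_cat => /or4P[/boxB|/box1|/box2|/box3]; rewrite /in_box; lia.
- apply: packing_cat => //; apply: packing_cat => //; first by apply: packing_block; lia.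
  apply: packing_cat => //; first by apply: packing_block; lia.
  by apply/packing_transpose/packing_block; lia.
- split=> i ib; rewrite count_cat.
    have [/rowsB/leq_trans->//|bi] := ltnP i b; first exact: leq_addr.
    apply: leq_trans (leq_addl _ _); rewrite /E; case: ifP => h0; first lia.
    by rewrite -(subnKC bi); apply: tight_block_rows; lia.
  have [/colsB/leq_trans->//|bi] := ltnP i b; first exact: leq_addr.
  apply: leq_trans (leq_addl _ _); rewrite /E.
  by case: ifP => h0; apply: tight_block_cols; lia.
Qed.

Definition packingb (s : seq diagonal) : bool :=
  all proper_diagonal s && all (fun x => all (fun y => clash x y ==> (x == y)) s) s.

Lemma packingbP (s : seq diagonal) : packingb s -> packing s.
Proof.
move=> /andP[/allP sP /allP sI]; split=> // x y /sI/allP h /h /implyP{}h c.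
exact/eqP/h.
Qed.

Definition balancedb (n : nat) (s : seq diagonal) : bool :=
  all (fun i => (3 <= count (hits_row i) s) && (3 <= count (hits_col i) s)) (iota 0 n).

Lemma balancedbP (n : nat) (s : seq diagonal) : balancedb n s -> balanced n n s.
Proof.
by move=> /allP h; split=> i lt_in; have /h/andP[] : i \in iota 0 n by rewrite mem_iota.
Qed.

(* Found by computer search: the first 8 (resp. 11) pairs already meet every
   row and column of the grid three times. *)
Definition base5 : seq diagonal :=
  [:: ((0,3),(3,2)); ((1,4),(4,1)); ((1,1),(2,0)); ((0,2),(4,3)); ((2,4),(3,0));
      ((0,0),(3,4)); ((1,2),(2,3)); ((0,1),(4,0)); ((0,4),(2,1)); ((1,0),(4,4));
      ((1,3),(2,2)); ((3,3),(4,2))].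

Definition base7 : seq diagonal :=
  [:: ((0,1),(3,4)); ((2,0),(4,6)); ((1,3),(5,5)); ((3,2),(6,4)); ((1,6),(4,3));
      ((0,5),(2,2)); ((5,0),(6,1)); ((1,2),(4,0)); ((0,4),(6,5)); ((2,6),(5,3));
      ((0,0),(3,1)); ((3,3),(4,5)); ((0,2),(2,3)); ((3,6),(6,3)); ((0,3),(6,6));
      ((0,6),(1,0)); ((3,0),(5,2)); ((3,5),(5,6)); ((4,2),(5,4)); ((1,4),(2,1));
      ((2,5),(6,0)); ((1,5),(4,4)); ((1,1),(6,2)); ((2,4),(5,1))].

(** [design_extend] excludes [h = 1], so [a = 7] starts from the 7 x 7 square. With [k0] equal to 8
    or 11, [k0 + 3m] is half of [3b] rounded up, hence at most [k]. *)
Lemma design_odd (a b k : nat) :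
  odd a -> odd b -> 5 <= a -> a <= b -> 3 * b <= 2 * k -> 2 * k <= a * b ->
  design a b k.
Proof.
move=> oa ob a5 ab bk kab.
have [a7|a7] := eqVneq a 7.
  have -> : a = 7 + 2 * 0 by [].
  have bE : b = 7 + 2 * (b - 7)./2 by lia.
  rewrite bE; apply: (@design_extend 7 11 0 _ _ base7) => //.
  - by apply/allP.
  - exact: packingbP.
  - exact: balancedbP.
  - lia.
  - by rewrite -bE addn0 -a7.
have aE : a = 5 + 2 * (a - 5)./2 by lia.
have bE : b = 5 + 2 * (b - 5)./2 by lia.
rewrite aE bE; apply: (@design_extend 5 8 _ _ _ base5) => //.
- by apply/allP.
- exact: packingbP.
- exact: balancedbP.
- lia.
- lia.
- by rewrite -aE -bE.
Qed.

Lemma design_exists (a b k : nat) :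
  3 <= a -> 3 <= b -> 3 * maxn a b <= 2 * k -> 2 * k <= a * b -> design a b k.
Proof.
move=> a3 b3 abk kab.
have even_case c d : 3 <= c -> 3 <= d -> ~~ odd d -> 3 * c <= 2 * k -> 3 * d <= 2 * k ->
    2 * k <= c * d -> design c d k.
  move=> c3 d3 ed ck dk kcd; have dE : d = 2 * d./2 by lia.
  by rewrite dE; apply: design_even; lia.
have [ob|eb] := boolP (odd b); last by apply: even_case => //; lia.
have [oa|ea] := boolP (odd a); last by apply/design_sym/even_case => //; rewrite ?[b * a]mulnC; lia.
(* If one side is 3, the bounds force [2k] to be three times the other side, which is odd. *)
have a5 : 5 <= a.
  have [a_eq3|] := eqVneq a 3; last lia.
  by move: kab abk; rewrite a_eq3; lia.
have b5 : 5 <= b.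
  have [b_eq3|] := eqVneq b 3; last lia.
  by move: kab abk; rewrite b_eq3; lia.
have [ab|ba] := leqP a b; first by apply: design_odd => //; lia.
by apply/design_sym/design_odd => //; rewrite ?[b * a]mulnC; lia.
Qed.

(** * Distances in the direct product *)

Lemma dist_adj (T : finType) (e : rel T) (x y : T) :
  x != y -> e x y -> dist e x y = Some 1.
Proof.
move=> xy exy; have : 1 < #|T| by apply/card_gt1P; exists x, y.
rewrite /dist; case: #|T| => [|[|n]] // _; rewrite /= (negPf xy) /=.
by case: existsP => // -[]; exists y; rewrite exy eqxx.
Qed.

(** [dist] searches only lengths below [#|T|], hence the bound on [#|T|]. *)
Lemma dist_common_neighbour (T : finType) (e : rel T) (x y z : T) :
  2 < #|T| -> x != y -> ~~ e x y -> e x z -> e z y -> dist e x y = Some 2.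
Proof.
rewrite /dist; case: #|T| => [|[|[|n]]] // _ xy nexy exz ezy; rewrite /= (negPf xy) /=.
case: existsP => [[u /andP[exu /eqP uy]]|_]; first by rewrite -uy exu in nexy.
case: existsP => // -[]; exists z; rewrite exz /=; apply/orP; right.
by apply/existsP; exists y; rewrite ezy eqxx.
Qed.

Lemma ord_avoid2 (m : nat) (x y : 'I_m) : 2 < m -> exists z, (z != x) && (z != y).
Proof.
move=> m2; have /subsetPn[z _] : ~~ ([set: 'I_m] \subset [set x; y]).
  apply/negP => /subset_leq_card; rewrite cardsT card_ord cards2.
  by case: (x != y); lia.
by rewrite !inE negb_or => zxy; exists z.
Qed.

Lemma KKK_dist (m1 m2 m3 : nat) (x y : KKK_vertex m1 m2 m3) :
  2 < m1 -> 2 < m2 -> 2 < m3 -> x != y ->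
  dist (KKK_adj m1 m2 m3) x y = Some (if KKK_adj m1 m2 m3 x y then 1 else 2).
Proof.
move=> h1 h2 h3 xy; case: ifPn => [|nxy]; first exact: dist_adj.
have [z1 /andP[z1x z1y]] := ord_avoid2 x.1.1 y.1.1 h1.
have [z2 /andP[z2x z2y]] := ord_avoid2 x.1.2 y.1.2 h2.
have [z3 /andP[z3x z3y]] := ord_avoid2 x.2 y.2 h3.
apply: (dist_common_neighbour (z := ((z1, z2), z3))) => //.
- rewrite !card_prod !card_ord; nia.
- by rewrite /KKK_adj /= ![_ == z1]eq_sym ![_ == z2]eq_sym ![_ == z3]eq_sym z1x z2x.
- by rewrite /KKK_adj /= z1y z2y.
Qed.

Lemma KKK_resolvingP (m1 m2 m3 : nat) (W : {set KKK_vertex m1 m2 m3}) :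
  2 < m1 -> 2 < m2 -> 2 < m3 ->
  resolving (KKK_adj m1 m2 m3) W <->
  (forall x y, x \notin W -> y \notin W -> x != y ->
   exists2 w, w \in W & KKK_adj m1 m2 m3 x w != KKK_adj m1 m2 m3 y w).
Proof.
move=> h1 h2 h3; split=> R x y xW yW xy; have [w wW dw] := R x y xW yW xy; exists w => //;
  have xw : x != w by [apply: contraNneq xW => ->];
  have yw : y != w by [apply: contraNneq yW => ->];
  move: dw; rewrite !KKK_dist //; by do 2!case: (KKK_adj _ _ _ _ _).
Qed.

(** * The lower bound *)

Definition layer (m1 m2 m3 : nat) (W : {set KKK_vertex m1 m2 m3}) (c : 'I_m3) :=
  [set w in W | w.2 == c].

Lemma card_le2_sub (T : finType) (x0 : T) (D : {set T}) :
  #|D| <= 2 -> exists u v, D \subset [set u; v].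
Proof.
have [->|[u uD]] := set_0Vmem D; first by exists x0, x0; rewrite sub0set.
have [Du|[v vD]] := set_0Vmem (D :\ u).
  by exists u, u; rewrite -(setD1K uD) Du setU0 setUid.
rewrite (cardsD1 u) uD (cardsD1 v) vD => D2; exists u, v.
rewrite -(setD1K uD) -(setD1K vD) (_ : D :\ u :\ v = set0) ?setU0 //.
by apply/eqP; rewrite -cards_eq0; lia.
Qed.

(* If two layers hold at most the cells [u], [v], some free cell shares a row
   or a column with both; it carries two vertices that [W] cannot separate. *)
Lemma card_two_layers (m1 m2 m3 : nat) (W : {set KKK_vertex m1 m2 m3}) (c c' : 'I_m3) :
  2 < m1 -> 2 < m2 -> 2 < m3 -> resolving (KKK_adj m1 m2 m3) W -> c != c' ->
  3 <= #|layer W c| + #|layer W c'|.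
Proof.
move=> h1 h2 h3 /KKK_resolvingP R cc'; rewrite leqNgt; apply/negP => lt3.
pose D := [set w.1 | w in layer W c :|: layer W c'].
have D2 : #|D| <= 2.
  apply: leq_trans (leq_imset_card _ _) _.
  exact: leq_trans (leq_card_setU _ _).1 lt3.
have h1' : 0 < m1 by lia. have h2' : 0 < m2 by lia.
have [u [v Duv]] := card_le2_sub (Ordinal h1', Ordinal h2') D2.
have inD w : w \in W -> (w.2 == c) || (w.2 == c') -> (w.1 == u) || (w.1 == v).
  move=> wW wc; rewrite -in_set2; apply: (subsetP Duv); apply/imsetP; exists w => //.
  by rewrite !inE wW.
suff [[a b] abD abuv] : exists2 p : 'I_m1 * 'I_m2, (p != u) && (p != v) &
    ((u.1 == p.1) || (u.2 == p.2)) && ((v.1 == p.1) || (v.2 == p.2)).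
  have free d : (d == c) || (d == c') -> ((a, b), d) \notin W.
    move=> dc; apply/negP => /inD /(_ dc) /=.
    by case/andP: abD => /negPf-> /negPf->.
  have [||| w wW] := R h1 h2 h3 ((a, b), c) ((a, b), c').
  - by apply: free; rewrite eqxx.
  - by apply: free; rewrite eqxx orbT.
  - by rewrite xpair_eqE negb_and cc' orbT.
  case wc : ((w.2 == c) || (w.2 == c')).
    have : (w.1.1 == a) || (w.1.2 == b).
      by move: (inD w wW wc) => /orP[]/eqP->; case/andP: abuv.
    rewrite /KKK_adj /= ![_ == w.1.1]eq_sym ![_ == w.1.2]eq_sym.
    by case/orP => -> /=; rewrite ?andbF.
  move/negbT: wc; rewrite negb_or /KKK_adj /= ![_ == w.2]eq_sym.
  by case/andP=> -> ->; rewrite eqxx.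
(* If [u] and [v] share a row or a column, another cell of that line works; otherwise the corner
   [(p, s)] does. *)
case: u v {Duv inD} => [p q] [r s] /=.
have [pr|pr] := eqVneq p r.
  have [b /andP[bq bs]] := ord_avoid2 q s h2.
  by exists (p, b); rewrite ?xpair_eqE /= ?(negPf bq) ?(negPf bs) ?andbF // pr eqxx.
have [qs|qs] := eqVneq q s.
  have [a /andP[ap ar]] := ord_avoid2 p r h1.
  by exists (a, q); rewrite ?xpair_eqE /= ?(negPf ap) ?(negPf ar) // qs eqxx !orbT.
exists (p, s); rewrite ?xpair_eqE /= ?eqxx ?orbT //.
by rewrite (negPf pr) eq_sym (negPf qs).
Qed.

Lemma card_layers (m1 m2 m3 : nat) (W : {set KKK_vertex m1 m2 m3}) :
  #|W| = \sum_(c < m3) #|layer W c|.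
Proof.
rewrite -sum1_card (partition_big (fun w => w.2) predT) //=.
by apply: eq_bigr => c _; rewrite -sum1_card; apply: eq_bigl => w; rewrite inE.
Qed.

(** If some layer has [w <= 1] points, each other one has at least [3 - w], and
    [w + (m3 - 1)(3 - w) >= 2 m3 - 1]. Otherwise the total is at least [2 m3]. *)
Lemma resolving_card_ge (m1 m2 m3 : nat) (W : {set KKK_vertex m1 m2 m3}) :
  2 < m1 -> 2 < m2 -> 2 < m3 -> resolving (KKK_adj m1 m2 m3) W -> 2 * m3 - 1 <= #|W|.
Proof.
move=> h1 h2 h3 R; rewrite card_layers.
have sum_const_ge (P : pred 'I_m3) n : (forall c, P c -> n <= #|layer W c|) ->
    #|P| * n <= \sum_(c < m3 | P c) #|layer W c|.
  by move=> Pn; rewrite -sum_nat_const; apply: leq_sum.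
have [/existsP[c0 c0W]|] := boolP [exists c, #|layer W c| <= 1].
  have /sum_const_ge : forall c, predC1 c0 c -> 3 - #|layer W c0| <= #|layer W c|.
    by move=> c cc0; rewrite leq_subLR addnC; apply: card_two_layers.
  rewrite cardC1 card_ord [X in _ -> _ <= X](bigD1 c0) //=.
  by case: #|layer W c0| c0W => [|[|]] // _; lia.
rewrite negb_exists => /forallP W2.
have /sum_const_ge : forall c, predT c -> 2 <= #|layer W c| by move=> c _; rewrite ltnNge.
by rewrite card_ord mulnC; apply/leq_trans/leq_subr.
Qed.

(** * The resolving set of a design *)

Definition cell (s : seq diagonal) (k : nat) (e : bool) : nat * nat :=
  let x := nth ((0, 0), (0, 0)) s k in if e then x.2 else x.1.

Lemma packing_cell_inj (s : seq diagonal) (k l : nat) (e f : bool) :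
  uniq s -> packing s -> k < size s -> l < size s ->
  cell s k e = cell s l f -> k = l.
Proof.
move=> us [_ sI] ks ls; rewrite /cell => E; apply/eqP.
rewrite -(nth_uniq ((0, 0), (0, 0)) ks ls us); apply/eqP/sI; rewrite ?mem_nth //.
by rewrite /clash /meets; case: e f E => -[] ->; rewrite eqxx ?orbT.
Qed.

(** The row of one cell and the column of the other form an opposite corner, so a coincidence makes
    the two pairs clash. *)
Lemma packing_corner_inj (s : seq diagonal) (k l : nat) (e f : bool) :
  uniq s -> packing s -> k < size s -> l < size s ->
  (cell s k e).1 = (cell s l f).1 -> (cell s k (~~ e)).2 = (cell s l (~~ f)).2 -> k = l.
Proof.
move=> us [_ sI] ks ls E1 E2; apply/eqP.
rewrite -(nth_uniq ((0, 0), (0, 0)) ks ls us); apply/eqP/sI; rewrite ?mem_nth //.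
rewrite /clash /meets /= !xpair_eqE; move: E1 E2; rewrite /cell.
by case: e f => -[] /= -> ->; rewrite !eqxx ?orbT.
Qed.

Lemma packing_cell_neq (s : seq diagonal) (k : nat) (e : bool) :
  packing s -> k < size s ->
  (cell s k e).1 != (cell s k (~~ e)).1 /\ (cell s k e).2 != (cell s k (~~ e)).2.
Proof.
move=> [sP _] ks; have /andP[h1 h2] := sP _ (mem_nth ((0, 0), (0, 0)) ks).
by rewrite /cell; case: e; split; rewrite //= eq_sym.
Qed.

Lemma count_ge3_nth (T : Type) (x0 : T) (P : pred T) (s : seq T) :
  3 <= count P s -> exists k1 k2 k3,
    [&& k1 < k2, k2 < k3 & k3 < size s] /\ [/\ P (nth x0 s k1), P (nth x0 s k2) & P (nth x0 s k3)].
Proof.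
pose t := [seq k <- iota 0 (size s) | P (nth x0 s k)].
have <- : size t = count P s.
  by rewrite size_filter -[in RHS](mkseq_nth x0 s) count_map.
have : sorted ltn t by apply/sorted_filter/iota_ltn_sorted; exact: ltn_trans.
have mem k : k \in t -> k < size s /\ P (nth x0 s k).
  by rewrite mem_filter mem_iota => /andP[].
case: t mem => [|k1 [|k2 [|k3 t]]] //= mem /and3P[k12 k23 _] _.
exists k1, k2, k3.
have [|_ h1] := mem k1; first by rewrite !inE eqxx.
have [|_ h2] := mem k2; first by rewrite !inE eqxx orbT.
have [|k3s h3] := mem k3; first by rewrite !inE eqxx !orbT.
by split=> //; apply/and3P.
Qed.

(* Three cells of a row lie in distinct columns and distinct layers, so one
   column and one layer cannot cover them all. *)
Lemma row_escape (s : seq diagonal) (i p q : nat) :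
  uniq s -> packing s -> 3 <= count (hits_row i) s ->
  exists k e, [/\ k < size s, (cell s k e).1 = i, (cell s k e).2.+1 != p & k.+1 != q].
Proof.
move=> us sP /(count_ge3_nth ((0, 0), (0, 0)))[k1 [k2 [k3 [ks [h1 h2 h3]]]]].
have hit k : hits_row i (nth ((0, 0), (0, 0)) s k) -> exists e, (cell s k e).1 = i.
  by case/orP=> /eqP E; [exists false|exists true].
have [e1 E1] := hit _ h1; have [e2 E2] := hit _ h2; have [e3 E3] := hit _ h3.
case/and3P: ks => k12 k23 k3s.
have k13 := ltn_trans k12 k23; have k2s := ltn_trans k23 k3s; have k1s := ltn_trans k12 k2s.
have neq k l e f : k < l -> l < size s -> (cell s k e).1 = i -> (cell s l f).1 = i ->
    (cell s k e).2 != (cell s l f).2.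
  move=> kl ls Ek El; apply/eqP => E.
  suff kl_eq : k = l by rewrite kl_eq ltnn in kl.
  apply: (packing_cell_inj us sP (ltn_trans kl ls) ls (e := e) (f := f)).
  by rewrite [LHS]surjective_pairing [RHS]surjective_pairing Ek El E.
have n12 := neq _ _ _ _ k12 k2s E1 E2; have n13 := neq _ _ _ _ k13 k3s E1 E3.
have n23 := neq _ _ _ _ k23 k3s E2 E3.
have [/andP[? ?]|bad1] := boolP (((cell s k1 e1).2.+1 != p) && (k1.+1 != q)).
  by exists k1, e1.
have [/andP[? ?]|bad2] := boolP (((cell s k2 e2).2.+1 != p) && (k2.+1 != q)).
  by exists k2, e2.
(* Columns and layers being distinct, one of the first two is excluded by [p] and the other by [q],
   so the third avoids both. *)
by exists k3, e3; split=> //; lia.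
Qed.

Lemma col_escape (s : seq diagonal) (j p q : nat) :
  uniq s -> packing s -> 3 <= count (hits_col j) s ->
  exists k e, [/\ k < size s, (cell s k e).2 = j, (cell s k e).1.+1 != p & k.+1 != q].
Proof.
move=> us sP hj.
have [|||k [e [ks Ej Ep Eq]]] := @row_escape (map transpose s) j p q.
- by rewrite (map_inj_uniq (inv_inj transposeK)).
- exact: packing_transpose.
- by rewrite count_map.
rewrite size_map in ks; exists k, e; move: Ej Ep.
by rewrite /cell (nth_map ((0, 0), (0, 0))) //; case: e.
Qed.

Lemma design_witness (n1 n2 n3 : nat) :
  2 <= n1 -> design n1 n2 n3 ->
  exists W : {set KKK_vertex n1.+1 n2.+1 n3.+1},
    [/\ #|W| = (2 * n3).+1,
        total_dominating (KKK_adj n1.+1 n2.+1 n3.+1) W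
      & forall x y, x != y -> exists2 w, w \in W &
          KKK_adj n1.+1 n2.+1 n3.+1 x w != KKK_adj n1.+1 n2.+1 n3.+1 y w].
Proof.
move=> n1_ge2 [s [us <- box sP [rows cols]]].
set m3 := size s in box rows cols *.
(* The shift by one leaves row, column and layer 0 to the single point [o]. *)
pose pt k e : KKK_vertex n1.+1 n2.+1 m3.+1 :=
  ((inord (cell s k e).1.+1, inord (cell s k e).2.+1), inord k.+1).
have cell_lt k e : k < m3 -> (cell s k e).1 < n1 /\ (cell s k e).2 < n2.
  by move/(mem_nth ((0, 0), (0, 0)))/box; rewrite /in_box /cell; case: e => /=; lia.
have adjE x k e : k < m3 -> KKK_adj n1.+1 n2.+1 m3.+1 x (pt k e) =
    [&& x.1.1 != (cell s k e).1.+1 :> nat, x.1.2 != (cell s k e).2.+1 :> nat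
      & x.2 != k.+1 :> nat].
  move=> km; have [h1 h2] := cell_lt k e km.
  by rewrite /KKK_adj /pt -!(inj_eq val_inj) /= !inordK.
pose o : KKK_vertex n1.+1 n2.+1 m3.+1 := ((ord0, ord0), ord0).
pose W := o |: [set pt p.1 p.2 | p : 'I_m3 * bool].
have ptW k e : k < m3 -> pt k e \in W.
  move=> km; rewrite !inE; apply/orP; right.
  by apply/imsetP; exists (Ordinal km, e).
have oW : o \in W by rewrite !inE eqxx.
exists W; split.
- rewrite cardsU1 card_imset ?card_prod ?card_ord ?card_bool.
    case: imsetP => [[[k e] _ /(congr1 (fun x => val x.2))]|_]; last by rewrite mulnC.
    by rewrite /= inordK // ltnS.
  (* The layer gives [k]; then the row gives [e], as the two cells of a pair lie in different
     rows. *)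
  move=> [k e] [l f] /(congr1 (fun x => (val x.1.1, val x.2))) /=.
  have [k1 _] := cell_lt k e (ltn_ord k); have [l1 _] := cell_lt l f (ltn_ord l).
  rewrite !inordK ?ltnS // => -[Ec /val_inj kl]; rewrite -{}kl in Ec *.
  have [+ _] := packing_cell_neq e sP (ltn_ord k); move: Ec.
  by case: e f {k1 l1} => -[] //= ->; rewrite eqxx.
- move=> x.
  (* Row 1 or row 2 differs from the row of [x]; a point of [W] there, off the column and layer of
     [x], is adjacent to [x]. *)
  have [i i1 ix] : exists2 i, i < n1 & x.1.1 != i.+1 :> nat.
    by case: (eqVneq (x.1.1 : nat) 1) => [->|?]; [exists 1|exists 0; lia].
  have [k [e [km Ei E2 E3]]] := row_escape x.1.2 x.2 us sP (rows i i1).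
  by exists (pt k e); rewrite ?ptW // adjE // Ei ix ![nat_of_ord _ == _]eq_sym E2.
move=> x y xy.
have [/existsP[w /andP[wW dw]]|] := boolP [exists w, (w \in W) &&
    (KKK_adj n1.+1 n2.+1 m3.+1 x w != KKK_adj n1.+1 n2.+1 m3.+1 y w)]; first by exists w.
rewrite negb_exists => /forallP same; case/negP: xy.
pose agree (u v : KKK_vertex n1.+1 n2.+1 m3.+1) := forall w, w \in W ->
  KKK_adj n1.+1 n2.+1 m3.+1 u w = KKK_adj n1.+1 n2.+1 m3.+1 v w.
have xyA : agree x y by move=> w wW; apply/eqP; have := same w; rewrite wW negbK.
have yxA : agree y x by move=> w wW; rewrite xyA.
(* A nonzero row of [u] would contain a point of [W] off the column and layer of [v], adjacent to
   [v] but not to [u]. *)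
have row0 u v : agree u v -> u.1.1 != v.1.1 -> u.1.1 = 0 :> nat.
  move=> uv; rewrite -(inj_eq val_inj) /=; case Eu : (u.1.1 : nat) => [//|i] iv.
  have i1 : i < n1 by rewrite -ltnS -Eu.
  have [k [e [km Ei E2 E3]]] := row_escape v.1.2 v.2 us sP (rows i i1).
  have := uv _ (ptW k e km); rewrite !adjE // Ei Eu eqxx /=.
  by rewrite eq_sym iv ![nat_of_ord _ == _]eq_sym E2 E3.
have col0 u v : agree u v -> u.1.2 != v.1.2 -> u.1.2 = 0 :> nat.
  move=> uv; rewrite -(inj_eq val_inj) /=; case Eu : (u.1.2 : nat) => [//|i] iv.
  have i1 : i < n2 by rewrite -ltnS -Eu.
  have [k [e [km Ei E2 E3]]] := col_escape v.1.1 v.2 us sP (cols i i1).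
  have := uv _ (ptW k e km); rewrite !adjE // Ei Eu eqxx /= andbF.
  by rewrite ![nat_of_ord _ == _]eq_sym iv E2 E3.
have x1 : x.1.1 = y.1.1.
  apply/eqP/negPn/negP => n; case/eqP: (n); apply: val_inj => /=.
  by rewrite (row0 x y) // (row0 y x) // eq_sym.
have x2 : x.1.2 = y.1.2.
  apply/eqP/negPn/negP => n; case/eqP: (n); apply: val_inj => /=.
  by rewrite (col0 x y) // (col0 y x) // eq_sym.
(* The points of [W] in the layer of [u] are not adjacent to [u], hence not to [v], which lies in
   another layer. So both share a row or column with [v], whose projection is then an opposite
   corner of pair [k]. *)
have corner u v k : agree u v -> u.1.1 = v.1.1 -> u.1.2 = v.1.2 -> u.2 != v.2 ->
    k.+1 = u.2 :> nat ->
    exists e, (cell s k e).1.+1 = u.1.1 :> nat /\ (cell s k (~~ e)).2.+1 = u.1.2 :> nat.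
  move=> uv u1 u2; rewrite -(inj_eq val_inj) /= => u3 Ek.
  have km : k < m3 by rewrite -ltnS Ek.
  have hit e : (u.1.1 == (cell s k e).1.+1 :> nat) || (u.1.2 == (cell s k e).2.+1 :> nat).
    have := uv _ (ptW k e km); rewrite !adjE // -u1 -u2 -Ek eqxx !andbF Ek.
    rewrite [nat_of_ord v.2 == _]eq_sym u3.
    by rewrite andbT => /esym/negbT; rewrite -negb_or negbK.
  have [n1' n2'] := packing_cell_neq true sP km.
  case/orP: (hit true) (hit false) => /eqP Et /orP[]/eqP Ef.
  - by move: n1'; rewrite /= -eqSS -Et -Ef eqxx.
  - by exists true; rewrite Et Ef.
  - by exists false; rewrite Et Ef.
  - by move: n2'; rewrite /= -eqSS -Et -Ef eqxx.
(* A corner has nonzero coordinates, so with [v] in layer 0 the point [o] is adjacent to [u] but not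
   to [v]. *)
have lay u v : agree u v -> u.1.1 = v.1.1 -> u.1.2 = v.1.2 -> u.2 != v.2 ->
    v.2 = 0 :> nat -> False.
  move=> uv u1 u2 u3 v3; case Ek : (u.2 : nat) => [|k].
    by case/eqP: u3; apply: val_inj; rewrite /= Ek v3.
  have [e [E1 E2]] := corner u v k uv u1 u2 u3 (esym Ek).
  by have := uv _ oW; rewrite /KKK_adj -!(inj_eq val_inj) /= -u1 -u2 -E1 -E2 Ek v3.
apply/eqP; rewrite [x]surjective_pairing [y]surjective_pairing; congr pair.
  by rewrite [x.1]surjective_pairing [y.1]surjective_pairing x1 x2.
apply/eqP/negPn/negP => n; have n' : y.2 != x.2 by rewrite eq_sym.
case Ey : (y.2 : nat) => [|l]; first exact: (lay x y).
case Ex : (x.2 : nat) => [|k]; first exact: (lay y x).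
(* The common projection is an opposite corner of both pairs [k] and [l], so these coincide. *)
have [e [E1 E2]] := corner x y k xyA x1 x2 n (esym Ex).
have [f [F1 F2]] := corner y x l yxA (esym x1) (esym x2) n' (esym Ey).
case/eqP: n; apply: val_inj; rewrite /= Ex Ey; congr S.
apply: (packing_corner_inj us sP (e := e) (f := f)).
- by rewrite -/m3 -ltnS -Ex.
- by rewrite -/m3 -ltnS -Ey.
- by apply: succn_inj; rewrite E1 F1 x1.
- by apply: succn_inj; rewrite E2 F2 x2.
Qed.

(** * Equality of the three minima *)

Theorem mainTheorem12 (n1 n2 n3 : nat) :
  3 <= n1 -> 3 <= n2 -> n1 <= n3 -> n2 <= n3 ->
  3 * maxn n1 n2 <= 2 * n3 -> 2 * n3 <= n1 * n2 ->
  let G := KKK_adj n1.+1 n2.+1 n3.+1 in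
  [/\ metric_dim_is G (2 * n3.+1 - 1),
      loc_dom_number_is G (2 * n3.+1 - 1)
    & loc_total_dom_number_is G (2 * n3.+1 - 1)].
Proof.
move=> n1_ge3 n2_ge3 n13 n23 lo hi G.
have n3_ge3 : 3 <= n3 := leq_trans n1_ge3 n13.
have [W [cardW totW sepW]] :=
  design_witness (ltnW n1_ge3) (design_exists n1_ge3 n2_ge3 lo hi).
have resW : resolving G W.
  by apply/KKK_resolvingP => [|||x y _ _ xy]; [lia|lia|lia|exact: sepW].
have domW : dominating G W by move=> v; right; exact: totW.
have cardWE : #|W| = 2 * n3.+1 - 1 by rewrite cardW; lia.
have low (V : {set KKK_vertex n1.+1 n2.+1 n3.+1}) :
  resolving G V -> 2 * n3.+1 - 1 <= #|V| by apply: resolving_card_ge; lia.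
by split; split; try (by exists W); [exact: low|move=> V []/low|move=> V []/low].
Qed.
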